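(* Let $\mathcal{O}$ be a discrete valuation ring with maximal ideal $\mathfrak{p}$, residue field $\mathcal{O}/\mathfrak{p}=\mathbb{F}_2$, and absolute ramification index $e=1$, that is, $2\mathcal{O}=\mathfrak{p}$. Let $n\geq 1$ and $\mathcal{O}_n=\mathcal{O}/\mathfrak{p}^n$. Let $\hat{\chi}\in\mathrm{Irr}(\mathrm{SL}_2(\mathcal{O}_n))$ be an irreducible complex character that is trivial on the centre of $\mathrm{SL}_2(\mathcal{O}_n)$. Then $\hat{\chi}$ is contained in the conjugation character of $\mathrm{SL}_2(\mathcal{O}_n)$.
   Context: For a finite group $G$, $\mathrm{Irr}(G)$ is the set of irreducible complex characters. The conjugation character of $G$ is the character of the complex permutation representation of $G$ given by the action of $G$ on itself by conjugation. A character is contained in it if it is one of its irreducible constituents. A character $\chi$ is trivial on a subgroup $H$ if $H\subseteq\ker\chi$. *)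

(* Defs.v *)
From HB Require Import structures.
From mathcomp Require Import all_boot all_order all_algebra all_fingroup.
From mathcomp Require Import all_solvable all_field all_character.
From mathcomp Require Import ring_quotient.
From mathcomp Require Import boolp.
Set Implicit Arguments.
Unset Strict Implicit.
Unset Printing Implicit Defensive.

Import GRing.Theory GroupScope.
Local Open Scope ring_scope.
Local Open Scope quotient_scope.

(* A discrete valuation ring is a local principal ideal domain that is not a  *)
(* field; a commutative ring is local when its non-units are closed under     *)
(* addition. [idealr_closed] only covers proper ideals, but the unit ideal is *)
(* principal anyway, and boolean predicates cover all ideals because the      *)
(* axioms of [boolp] make every proposition decidable.                        *)
HB.mixin Record isDVR O of GRing.IntegralDomain O := {
  dvr_local : forall x y : O, x \isn't a GRing.unit -> y \isn't a GRing.unit ->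
    x + y \isn't a GRing.unit;
  dvr_principal : forall I : {pred O}, idealr_closed I ->
    exists a : O, forall x : O, x \in I <-> exists y : O, x = a * y;
  dvr_not_field : exists x : O, x != 0 /\ x \isn't a GRing.unit
}.

#[short(type="dvrType")]
HB.structure Definition DVR := {O of isDVR O & GRing.IntegralDomain O}.

Section IdealPower.
Variables (R : comNzRingType) (I : idealr R) (n : nat).

(* The elements of I ^ n are the finite sums of products of n elements of I.  *)
Definition in_ideal_pow (x : R) : Prop :=
  exists2 s : seq (n.-tuple R), {in s, forall t, forall i, tnth t i \in I}
                              & x = \sum_(t <- s) \prod_(i < n) tnth t i.

(* The positivity of n, which makes I ^ n a proper ideal, is an argument so   *)
(* that the ideal structure can be inferred.                                  *)
Definition ideal_pow (n_gt0 : (0 < n)%N) : {pred R} :=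
  fun x => `[< in_ideal_pow x >].

Lemma ideal_pow_closed (n_gt0 : (0 < n)%N) : idealr_closed (ideal_pow n_gt0).
Proof.
split.
- by apply/asboolP; exists [::] => //; rewrite big_nil.
- apply/asboolP => -[s sI E].
  have: (1 : R) \in I.
    rewrite E big_seq; apply: rpred_sum => t ts.
    rewrite (bigD1 (Ordinal n_gt0)) //= mulrC.
    by apply: idealMr; apply: sI.
  by rewrite idealr1.
move=> a u v /asboolP[s sI ->] /asboolP[s' s'I ->]; apply/asboolP.
pose sc (t : n.-tuple R) : n.-tuple R :=
  [tuple (if i == Ordinal n_gt0 then a * tnth t i else tnth t i) | i < n].
exists ([seq sc t | t <- s] ++ s').
  move=> t; rewrite mem_cat => /orP[/mapP[{}t ts ->] i|/s'I//].
  by rewrite tnth_mktuple; case: ifP => _; first apply: idealMr; apply: sI.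
rewrite big_cat big_map mulr_sumr; congr (_ + _).
apply: eq_bigr => t _.
rewrite (bigD1 (Ordinal n_gt0)) // [RHS](bigD1 (Ordinal n_gt0)) //=.
rewrite tnth_mktuple eqxx mulrA; congr (_ * _).
by apply: eq_bigr => i /negPf ni; rewrite tnth_mktuple ni.
Qed.

HB.instance Definition _ (n_gt0 : (0 < n)%N) :=
  isIdealr.Build R (ideal_pow n_gt0) (ideal_pow_closed n_gt0).

End IdealPower.

Definition max_ideal (O : dvrType) : {pred O} :=
  fun x => x \isn't a GRing.unit.

Lemma max_ideal_closed (O : dvrType) : idealr_closed (@max_ideal O).
Proof.
split; first by rewrite unfold_in unitr0.
  by rewrite unfold_in unitr1.
move=> a u v u' v'; rewrite unfold_in; apply: dvr_local => //.
by rewrite unitrM negb_and (u' : u \isn't a GRing.unit) orbT.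
Qed.

HB.instance Definition _ (O : dvrType) :=
  isIdealr.Build O (@max_ideal O) (@max_ideal_closed O).

Definition residue_field (O : dvrType) := {ideal_quot (@max_ideal O)}.
HB.instance Definition _ (O : dvrType) := GRing.ComNzRing.on (residue_field O).

Definition residue_field_is_F2 (O : dvrType) : Prop :=
  exists f : {rmorphism residue_field O -> 'F_2}, bijective f.

(* 2 O = p, as subsets of O *)
Definition absolute_ramification_index_one (O : dvrType) : Prop :=
  forall x : O, x \in @max_ideal O <-> exists y : O, x = 2%:R * y.

(* The ring O / p ^ n. The unused hypothesis on the residue field is an       *)
(* argument so that the finiteness of the quotient can be inferred.           *)
Definition quotient_ring (O : dvrType) (resO : residue_field_is_F2 O)
    (n : nat) (n_gt0 : (0 < n)%N) : Type :=
  {ideal_quot (ideal_pow (@max_ideal O) n_gt0)}.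

Section QuotientRing.
Variables (O : dvrType) (resO : residue_field_is_F2 O).
Variables (n : nat) (n_gt0 : (0 < n)%N).
Local Notation On := (quotient_ring resO n_gt0).
Local Notation quot := {ideal_quot (ideal_pow (@max_ideal O) n_gt0)}.
Local Notation p := (@max_ideal O).

HB.instance Definition _ := GRing.ComNzRing.on On.

Definition quotient_unit : pred On := fun x => `[< exists y : On, y * x = 1 >].

Definition quotient_inv (x : On) : On :=
  if pselect (exists y : On, y * x = 1) is left ex then sval (cid ex) else x.

Fact quotient_mulVx : {in quotient_unit, left_inverse 1 quotient_inv *%R}.
Proof.
move=> x /asboolP ux; rewrite /quotient_inv; case: pselect => // ex.
by case: (cid ex).
Qed.

Fact quotient_unitPl (x y : On) : y * x = 1 -> x \in quotient_unit.
Proof. by move=> yx; apply/asboolP; exists y. Qed.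

Fact quotient_inv_out : {in [predC quotient_unit], quotient_inv =1 id}.
Proof.
move=> x /asboolPn ux; rewrite /quotient_inv; case: pselect => // ex.
Qed.

HB.instance Definition _ := GRing.ComNzRing_hasMulInverse.Build On
  quotient_mulVx quotient_unitPl quotient_inv_out.

Lemma max_ideal_gen :
  exists a : O, forall x : O, x \in p <-> exists y : O, x = a * y.
Proof. exact: dvr_principal (@max_ideal_closed O). Qed.

Lemma residue_digit (x : O) : exists b : bool, x - b%:R \in p.
Proof.
case: resO => f bij_f; have inj_f := bij_inj bij_f.
pose q : O -> residue_field O := \pi_(residue_field O).
suff [b Eb] : exists b : bool, q x = q b%:R.
  by exists b; move/eqP: Eb; rewrite -Quotient.idealrBE.
have qB (b : bool) : f (q b%:R) = b%:R.
  have -> : q b%:R = b%:R by rewrite /q; case: b; rewrite ?rmorph1 ?rmorph0.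
  by rewrite rmorph_nat.
case E : (f (q x)) => [[|[|m]] hm] //.
- by exists false; apply: inj_f; rewrite E qB; apply: val_inj.
- by exists true; apply: inj_f; rewrite E qB; apply: val_inj.
Qed.

Lemma digit_expansion (a : O) : (forall x : O, x \in p -> exists y, x = a * y) ->
  forall m (x : O), exists t : m.-tuple bool, exists y : O,
    x = \sum_(i < m) (tnth t i)%:R * a ^+ i + a ^+ m * y.
Proof.
move=> pa; elim=> [|m IHm] x.
  by exists [tuple], x; rewrite big_ord0 add0r expr0 mul1r.
have [b /pa[z Ez]] := residue_digit x.
have [t [y Ey]] := IHm z.
exists [tuple of b :: t], y.
rewrite big_ord_recl tnth0 expr0 mulr1 exprS -mulrA -addrA.
have -> : x = b%:R + a * z by rewrite -Ez addrC subrK.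
congr (_ + _); rewrite {1}Ey mulrDr mulr_sumr; congr (_ + _).
by apply: eq_bigr => i _; rewrite tnthS /= /bump /= add1n exprS mulrCA.
Qed.

Lemma quotient_ring_enum : exists s : seq On, forall x : On, x \in s.
Proof.
have [a ap] := max_ideal_gen.
have pa x : x \in p -> exists y, x = a * y by move/ap.
have a_in : a \in p by apply/ap; exists 1; rewrite mulr1.
exists [seq \pi_quot (\sum_(i < n) (tnth t i)%:R * a ^+ i)
       | t : n.-tuple bool <- enum {: n.-tuple bool}]; elim/quotW => x.
have [t [y Ey]] := digit_expansion pa n x.
apply/mapP; exists t; first by rewrite mem_enum.
apply/eqP; rewrite -Quotient.idealrBE Ey addrC addKr mulrC.
apply: idealMr; apply/asboolP; exists [:: nseq_tuple n a].
  by move=> t0; rewrite inE => /eqP-> i; rewrite tnth_nseq.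
rewrite big_seq1 (eq_bigr (fun=> a)) => [|i _]; last by rewrite tnth_nseq.
by rewrite prodr_const card_ord.
Qed.

Definition quotient_ring_seq : seq On := undup (sval (cid quotient_ring_enum)).

Fact quotient_ring_seqP : Finite.axiom quotient_ring_seq.
Proof.
move=> x; rewrite count_uniq_mem ?undup_uniq // mem_undup.
by case: cid => s /= ->.
Qed.

Fact quotient_ring_indexK :
  pcancel (fun x : On => index x quotient_ring_seq) (onth quotient_ring_seq).
Proof.
move=> x; have xs : x \in quotient_ring_seq.
  by rewrite -has_pred1 has_count quotient_ring_seqP.
by rewrite /= onthE (nth_map x) ?index_mem // nth_index.
Qed.

HB.instance Definition _ := Choice_isCountable.Build On quotient_ring_indexK.

HB.instance Definition _ := isFinite.Build On quotient_ring_seqP.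

End QuotientRing.

Section SpecialLinear.
Variables (m : nat) (R : finComUnitRingType).

Definition SLgroup : {set {'GL_m[R]}} := [set g | \det (GLval g) == 1].

Fact SLgroup_set : group_set SLgroup.
Proof.
apply/group_setP; split; first by rewrite inE GL_1E det1.
by move=> g h; rewrite !inE GL_ME det_mulmx => /eqP-> /eqP->; rewrite mulr1.
Qed.

Canonical SLgroup_group := Group SLgroup_set.

End SpecialLinear.

Notation "''SL_' m [ R ]" := (SLgroup m R)
  (at level 8, m at level 2, format "''SL_' m [ R ]") : group_scope.
Notation "''SL_' m [ R ]" := (SLgroup_group m R) : Group_scope.

Section ConjugationCharacter.
Variables (gT : finGroupType) (G : {group gT}).

(* Row vectors over 'I_#|G| form the permutation module on G, the basis       *)
(* vector of index i being attached to [enum_val i]; matrices act on the      *)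
(* right, so x sends the basis vector of g to that of g ^ x = x^-1 * g * x.   *)
Definition conj_mx (x : gT) : 'M[algC]_#|G| :=
  \matrix_i delta_mx 0 (gring_index G (enum_val i ^ x)%g).

Fact conj_mx_repr : mx_repr G conj_mx.
Proof.
split=> [|x y Gx Gy]; apply/row_matrixP=> i; rewrite !rowK.
  by rewrite conjg1 row1 gring_valK.
by rewrite row_mul rowK -rowE rowK conjgM gring_indexK // groupJ ?enum_valP.
Qed.

Canonical conj_repr := MxRepresentation conj_mx_repr.

Definition conjugation_character : 'CF(G) := cfRepr conj_repr.

End ConjugationCharacter.

(* Main.v *)
Require Import Defs.
From HB Require Import structures.
From mathcomp Require Import all_boot all_order all_algebra all_fingroup.
From mathcomp Require Import all_solvable all_field all_character.
From mathcomp Require Import ring_quotient boolp ring.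
Set Implicit Arguments.
Unset Strict Implicit.
Unset Printing Implicit Defensive.
Import Order.TTheory Num.Theory.
Import GRing.Theory GroupScope.
Local Open Scope group_scope.
Local Open Scope ring_scope.

(** Let [G] be a finite group and [chi] an irreducible character of [G]. The
value of the conjugation character at [x] is the order of the centraliser of
[x], so its inner product with [chi] is, up to a positive factor, the sum over
[g] of the values of [chi] on ['C_G[g]]. Every term of this sum is non-negative,
hence [chi] is a constituent as soon as it has a non-zero vector fixed by some
centraliser ([constt_conjugation_of_centraliser]). By the second orthogonality
relation the conjugation character is also the sum of all [theta * theta^*],
hence [chi] is a constituent as soon as [chi * theta] contains [theta] for one
irreducible [theta] ([constt_conjugation_of_irr]).

The ring [R = O / p ^ n] enters through two properties: every element is [2 * y]
or [1 + 2 * y], and [2 ^ n = 0]. Let [T] be the diagonal torus of [SL_2(R)], and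
let [chi] be trivial on the centre.

Suppose that [T] is not contained in the kernel of [chi]. The elements of [T] of
order 2 are central, so every character of [T] occurring in [chi] is trivial on
them and is therefore the inverse of a square [lambda ^ 2]
([exists_inverse_square_root]). Among the [lambda] obtained from non-trivial
constituents choose one whose conductor [2 ^ k] is the largest. Extend it to the
group [B] of matrices that are upper triangular modulo [2 ^ k], and let [theta]
be the character induced from [B]. It is irreducible by Mackey's criterion
([borel_weight_regular]). The double coset of the Weyl element [w] contributes
to the multiplicity of [theta] in [chi * theta] the multiplicity of
[lambda ^ -2] in the restriction of [chi] to the intersection of [B] and its
conjugate by [w], that is, to the matrices that are diagonal modulo [2 ^ k]. The
maximality of the conductor makes the kernel of [chi] contain the principal
congruence subgroup of level [2 ^ k] ([conductor_unipotents]), so this is a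
multiplicity in the restriction to [T], and it is positive.

Suppose now that [T] is contained in the kernel [N] of [chi]. Commutators with
[T] put all unipotent matrices of level 8 in [N], and then the centraliser of
the element [t] of order 3 given by [elliptic] is contained in [<[t]> N]. If
[chi] has no [t]-fixed vector, then [1 + t + t ^ 2] acts as 0. The conjugates by
[t] of an upper unipotent matrix of level 4 act as three involutions of product
1, and these are forced to be trivial ([klein_four_fixed_point_free]). Thus
level 4 is in [N], and likewise level 2, so [chi] factors through
[SL_2(F_2) = S_3]. The centraliser of a transvection [u] is then contained in
[<[u]> N], and [u] cannot act as -1, since it inverts [t] modulo [N]; so [chi]
has a vector fixed by the centraliser of [u]. *)

(** * Multiplicative functions and linear characters *)

Lemma linear_char_of_morph (gT : finGroupType) (K : {group gT})
    (f : gT -> algC) :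
    f 1%g = 1%R -> {in K &, forall x y, f (x * y)%g = (f x * f y)%R} ->
  exists2 phi : 'CF(K), phi \is a linear_char & {in K, phi =1 f}.
Proof.
move=> f1 fM; pose r x : 'M[algC]_1 := (f x)%:M.
have rP : mx_repr K r.
  by split=> [|x y Kx Ky]; rewrite /r ?f1 // fM // scalar_mxM.
exists (cfRepr (MxRepresentation rP)) => [|x Kx].
  by rewrite qualifE /= cfRepr_char cfRepr1 eqxx.
by rewrite cfunE Kx mulr1n mxtrace_scalar mulr1n.
Qed.

Lemma morph_eq1_of_sum_neq0 (gT : finGroupType) (K : {group gT})
    (f : gT -> algC) :
    {in K &, forall x y, f (x * y)%g = (f x * f y)%R} ->
  (\sum_(x in K) f x != 0)%R -> {in K, forall x, f x = 1%R}.
Proof.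
move=> fM S0 x Kx; apply: (mulIf S0); rewrite mul1r mulr_sumr.
rewrite [RHS](reindex_inj (mulgI x)) /=.
by apply: eq_big => [y|y Ky]; rewrite ?groupMl // fM.
Qed.

(** * Constituents of the conjugation character *)

Section ConjugationCharacter.
Variables (gT : finGroupType) (G : {group gT}).

Lemma conjugation_characterE x :
  x \in G -> conjugation_character G x = #|'C_G[x]|%:R.
Proof.
move=> Gx; rewrite cfunE Gx mulr1n /mxtrace.
rewrite (eq_bigr (fun i => (x \in 'C[enum_val i])%:R)) => [|i _]; last first.
  rewrite mxE mxE eqxx /= cent1C; congr (_%:R); congr (nat_of_bool _).
  rewrite -(inj_eq enum_val_inj) gring_indexK ?groupJ ?enum_valP //.
  by rewrite eq_sym (sameP eqP conjg_fixP) (sameP commgP cent1P).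
rewrite -(big_enum_val (A := mem G) (fun g => (x \in 'C[g])%:R)) /=.
rewrite -natr_sum; congr _%:R; rewrite -sum1_card [RHS]big_mkcond /=.
rewrite [LHS]big_mkcond /=; apply: eq_bigr => g _.
by rewrite in_setI cent1C; case: (g \in G) => //=; case: (g \in 'C[x]).
Qed.

Lemma conjugation_character_sum :
  conjugation_character G = (\sum_j 'chi[G]_j * ('chi_j)^*%CF)%R.
Proof.
apply/cfun_inP=> x Gx; rewrite conjugation_characterE //.
rewrite sum_cfunE; under eq_bigr do rewrite !cfunE.
by rewrite (second_orthogonality_relation x Gx) class_refl mulr1n.
Qed.

Lemma constt_conjugation_of_irr (i j : Iirr G) :
  ('['chi_i * 'chi_j, 'chi_j]_G != 0)%R ->
  i \in irr_constt (conjugation_character G).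
Proof.
move=> n0; rewrite irr_consttE conjugation_character_sum cfdot_suml.
have nn k : (0 <= '['chi[G]_k * ('chi_k)^*%CF, 'chi_i])%R.
  rewrite natr_ge0 ?Cnat_cfdot_char ?irr_char ?rpredM ?irr_char //.
  by rewrite cfConjC_char irr_char.
rewrite psumr_neq0 => [|k _]; last exact: nn.
apply/hasP; exists j; rewrite ?mem_index_enum //= lt_def nn andbT.
apply: contraNneq n0 => E0; rewrite cfdotC; apply/eqP.
have -> : ('['chi_j, 'chi_i * 'chi_j] = '['chi_j * ('chi_j)^*%CF, 'chi_i])%R.
  rewrite !cfdotE; congr (_ * _)%R; apply: eq_bigr => x Gx.
  by rewrite !cfunE rmorphM /= mulrAC mulrA.
by rewrite E0 conjC0.
Qed.

(** The inner product is a sum over the pairs of commuting elements; summing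
first over the second component writes it with the non-negative numbers
[S g = #|'C_G[g]| * '['Res 'chi_i, 1]]. *)
Lemma constt_conjugation_of_centraliser (i : Iirr G) g : g \in G ->
    (\sum_(x in 'C_G[g]) 'chi_i x != 0)%R ->
  i \in irr_constt (conjugation_character G).
Proof.
move=> Gg n0; rewrite irr_consttE cfdotC conjC_eq0 cfdotE.
rewrite mulf_neq0 ?invr_eq0 ?neq0CG //.
pose S h := (\sum_(x in 'C_G[h]) 'chi_i x)%R.
have Snn h : (0 <= S h)%R.
  have E : S h = (#|'C_G[h]|%:R * '['Res['C_G[h]] 'chi_i, 1])%R.
    rewrite cfdotE mulVKf ?neq0CG //; apply: eq_bigr => x Cx.
    by rewrite cfun1E Cx conjC1 mulr1 cfResE ?subsetIl.
  rewrite E mulr_ge0 ?ler0n // natr_ge0 // Cnat_cfdot_char ?cfun1_char //.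
  by rewrite cfRes_char ?irr_char.
suff -> : (\sum_(x in G) 'chi_i x * (conjugation_character G x)^*
          = \sum_(h in G) S h)%R.
  rewrite psumr_neq0 //; apply/hasP; exists g; first exact: mem_index_enum.
  by rewrite Gg lt_def Snn n0.
rewrite /S; under [RHS]eq_bigr do rewrite big_mkcond /=.
rewrite [RHS](exchange_big_dep predT) //= [LHS]big_mkcond /=.
apply: eq_bigr => x _; case: ifP => Gx; last first.
  by rewrite big1 // => h _; rewrite inE Gx.
rewrite conjugation_characterE // conjC_nat mulr_natr -sumr_const -big_mkcondr.
rewrite [RHS](eq_bigl (fun h => h \in 'C_G[x])) // => h.
by rewrite !in_setI Gx /= andbT cent1C.
Qed.

End ConjugationCharacter.

(** * Constituents from monomial characters *)

Section Monomial.
Variables (gT : finGroupType) (G H : {group gT}) (f : gT -> algC).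
Hypotheses (sHG : H \subset G) (f1 : f 1%g = 1%R).
Hypothesis fM : {in H &, forall x y, f (x * y)%g = (f x * f y)%R}.

(** Mackey's formula, before grouping the [y] by double cosets: this form
avoids choosing representatives. *)
Lemma cfdot_mul_Ind (phi : 'CF(H)) (chi : 'CF(G)) : {in H, phi =1 f} ->
  '[chi * 'Ind[G] phi, 'Ind[G] phi]
  = (#|H|%:R^-1 * #|H|%:R^-1 *
      \sum_(y in G) \sum_(h in H :&: H :^ y^-1) chi h * f h * (f (h ^ y))^*)%R.
Proof.
move=> phiE; rewrite [X in '[X, _]]mulrC -cfIndM // -Frobenius_reciprocity.
rewrite cfdotE -mulrA.
congr (_ * _); rewrite (eq_bigr (fun h => #|H|%:R^-1 *
   \sum_(y in G) chi h * f h * (phi (h ^ y)%g)^*)); last first.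
  move=> h Hh; rewrite !cfunE cfResE // cfResE ?cfIndE ?(subsetP sHG) // phiE //.
  rewrite rmorphM fmorphV rmorph_nat rmorph_sum /= mulrCA; congr (_ * _).
  by rewrite mulr_sumr; apply: eq_bigr => y _; rewrite [chi h * _]mulrC.
rewrite -mulr_sumr exchange_big /=; congr (_ * _); apply: eq_bigr => y Gy.
rewrite [RHS]big_mkcond [LHS]big_mkcond /=.
apply: eq_bigr => h _; rewrite inE mem_conjgV.
case: ifP => //= Hh; case: ifP => Hhy; first by rewrite phiE.
by rewrite [phi _]cfun0 ?Hhy // rmorph0 mulr0.
Qed.

Hypothesis regular : forall y, y \in G -> y \notin H ->
  exists h, [/\ h \in H, (h ^ y)%g \in H & f (h ^ y)%g != f h].

(** The hypothesis [regular] makes the terms of [cfdot_mul_Ind] with [y] outside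
[H] vanish for [chi = 1], so the induced character is irreducible. For
[chi = 'chi_i] each term is a non-negative multiple of a multiplicity, hence one
non-zero term is enough. *)
Lemma constt_conjugation_monomial (i : Iirr G) w : w \in G ->
    (\sum_(h in H :&: H :^ w^-1) 'chi_i h * f h * (f (h ^ w))^* != 0)%R ->
  i \in irr_constt (conjugation_character G).
Proof.
move=> Gw Sw; have [phi Lphi phiE] := linear_char_of_morph f1 fM.
have Nphi := lin_charW Lphi.
have fV x : x \in H -> (f x * (f x)^* = 1)%R.
  move=> Hx; rewrite -phiE // -lin_charV_conj // -lin_charM ?groupV //.
  by rewrite mulgV lin_char1.
have fMJ y : {in H :&: H :^ y^-1 &, forall a b,
    (f (a * b)%g * (f ((a * b) ^ y)%g)^* =
     f a * (f (a ^ y)%g)^* * (f b * (f (b ^ y)%g)^*))%R}.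
  move=> a b; rewrite !inE !mem_conjgV => /andP[Ha Hay] /andP[Hb Hby].
  by rewrite conjMg fM // (fM Hay Hby) rmorphM /= mulrACA.
have irrI : 'Ind[G] phi \in irr G.
  rewrite irrEchar cfInd_char //=; apply/eqP.
  rewrite -[X in '[X, _]]mul1r (cfdot_mul_Ind _ phiE).
  rewrite (bigID (fun y => y \in H)) /= [X in (_ + X)%R]big1 => [|y /andP[Gy Hy]].
    rewrite addr0 (eq_bigl (fun y => y \in H)) => [|y]; last first.
      by rewrite andbC; case: (boolP (y \in H)) => //= /(subsetP sHG).
    rewrite (eq_bigr (fun=> #|H|%:R)) => [|y Hy].
      rewrite sumr_const -[X in _ * X]mulr_natr -invfM mulVf //.
      by rewrite mulf_neq0 ?neq0CG.
    rewrite conjGid ?groupV // setIid (eq_bigr (fun=> 1%R)) ?sumr_const // => h Hh.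
    rewrite cfun1E (subsetP sHG) // mul1r -phiE ?cfunJ //.
    rewrite -[in X in (_ * X^*)%R]phiE ?groupJ //.
    by rewrite cfunJ // phiE // fV.
  rewrite (eq_bigr (fun h => f h * (f (h ^ y))^*)%R) => [|h /setIP[Hh _]]; last first.
    by rewrite cfun1E (subsetP sHG) // mul1r.
  apply/eqP/negPn/negP => /(@morph_eq1_of_sum_neq0 _ [group of H :&: H :^ y^-1]
    (fun h => f h * (f (h ^ y))^*)%R (@fMJ y)) f1y.
  have [h [Hh Hhy /eqP[]]] := regular Gy Hy.
  have := f1y h; rewrite inE mem_conjgV Hh Hhy => /(_ isT) E.
  rewrite -[LHS]mul1r -(E : f h * (f (h ^ y)%g)^* = 1) -mulrA [_^* * _]mulrC.
  by rewrite fV // mulr1.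
have [j Ej] := irrP irrI.
apply: (@constt_conjugation_of_irr _ _ i j); rewrite -Ej (cfdot_mul_Ind _ phiE).
rewrite mulf_neq0 ?mulf_neq0 ?invr_eq0 ?neq0CG //.
have nn y : y \in G ->
  (0 <= \sum_(h in H :&: H :^ y^-1) 'chi_i h * f h * (f (h ^ y))^*)%R.
  move=> Gy; pose K := [group of H :&: H :^ y^-1].
  have sKG : K \subset G by rewrite (subset_trans (subsetIl _ _)).
  have [||psi Lpsi psiE] :=
    @linear_char_of_morph _ K (fun h => (f h)^* * f (h ^ y)%g)%R.
  - by rewrite conj1g f1 conjC1 mulr1.
  - move=> a b Ka Kb; have := congr1 (fun z => z^*)%R (@fMJ y a b Ka Kb).
    by rewrite !rmorphM /= !conjCK.
  suff -> : (\sum_(h in H :&: H :^ y^-1) 'chi_i h * f h * (f (h ^ y))^*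
            = #|K|%:R * '['Res[K] 'chi_i, psi])%R.
    rewrite mulr_ge0 ?ler0n // natr_ge0 // Cnat_cfdot_char ?(lin_charW Lpsi) //.
    by rewrite cfRes_char ?irr_char.
  rewrite cfdotE mulVKf ?neq0CG //; apply: eq_bigr => h Kh.
  by rewrite cfResE // psiE // rmorphM /= conjCK mulrA.
rewrite psumr_neq0 //; apply/hasP; exists w; first exact: mem_index_enum.
by rewrite Gw lt_def Sw nn.
Qed.

End Monomial.

(** * Square roots of characters and fixed vectors *)

(** Summing over all characters [lambda] of [D] the inner products of
[lambda ^ 2] with [mu^*] gives the sum of [mu] over the elements of square 1,
because the sum of all [lambda] is the regular character. That sum is not 0, so
some [lambda ^ 2] is equal to [mu^*]. *)
Lemma exists_inverse_square_root (gT : finGroupType) (D : {group gT})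
    (mu : Iirr D) :
    abelian D -> {in D, forall x, (x * x)%g = 1%g -> 'chi_mu x = 1} ->
  exists j : Iirr D, {in D, forall x, 'chi_j x * 'chi_j x * 'chi_mu x = 1}.
Proof.
move=> abD mu1.
have lin k : 'chi[D]_k \is a linear_char by apply/char_abelianP.
have : \sum_(j : Iirr D) \sum_(x in D) 'chi_j (x * x)%g * 'chi_mu x != 0.
  rewrite exchange_big /= (eq_bigr (fun x => (#|D| * ((x * x)%g == 1%g))%:R)).
    rewrite -natr_sum pnatr_eq0 -lt0n (bigD1 1%g) //= mulg1 eqxx muln1.
    by rewrite addn_gt0 cardG_gt0.
  move=> x Dx; rewrite -mulr_suml.
  have -> : \sum_j 'chi[D]_j (x * x)%g = cfReg D (x * x)%g.
    rewrite cfReg_sum sum_cfunE; apply: eq_bigr => j _.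
    by rewrite cfunE lin_char1 // mul1r.
  rewrite cfRegE; case: eqP => [/mu1->|_] //; last by rewrite muln0 mul0r.
  by rewrite muln1 mulr1 mulr1n.
have [j n0 _|all0] := pickP (fun j : Iirr D => 
    \sum_(x in D) 'chi_j (x * x)%g * 'chi_mu x != 0); last first.
  by rewrite big1 ?eqxx // => j _; apply/eqP; have := all0 j; case: eqP.
exists j => x Dx; rewrite -(lin_charM (lin j)) //.
move: x Dx; apply: morph_eq1_of_sum_neq0 n0 => a b Da Db.
have -> : ((a * b) * (a * b) = (a * a) * (b * b))%g.
  by rewrite -!mulgA; congr (_ * _)%g; rewrite !mulgA (centsP abD b Db a Da).
by rewrite (lin_charM (lin j)) ?groupM // (lin_charM (lin mu)) // mulrACA.
Qed.

(** The trace of an idempotent is its rank. *)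
Lemma idempotent_mx_trace0 (F : numFieldType) (n : nat) (E : 'M[F]_n) :
  E *m E = E -> \tr E = 0 -> E = 0.
Proof.
move=> EE trE; set r := \rank E.
have RC : row_base E *m col_base E = 1%:M.
  apply: (row_full_inj (col_base_full E)); apply: (row_free_inj (row_base_free E)).
  by rewrite mulmx1 mulmxA mulmx_base -mulmxA mulmx_base.
apply/eqP; rewrite -mxrank_eq0 -(pnatr_eq0 F) -mxtrace1 -RC mxtrace_mulC.
by rewrite mulmx_base trE.
Qed.

(** The left-hand side is the order of [C] times the dimension of the space of
[C]-fixed vectors, onto which the sum on the right projects. *)
Lemma repr_sum_eq0 (gT : finGroupType) (G C : {group gT}) (n : nat)
    (rG : mx_representation algC G n) : C \subset G ->
  \sum_(x in C) cfRepr rG x = 0 -> \sum_(x in C) rG x = 0.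
Proof.
move=> /subsetP sCG S0; set S := \sum_(x in C) rG x.
have rS x : x \in C -> rG x *m S = S.
  move=> Cx; rewrite mulmx_sumr [RHS](reindex_inj (mulgI x)) /=.
  by apply: eq_big => y; rewrite ?groupMl // => Cy; rewrite repr_mxM ?sCG.
have nC : #|C|%:R != 0 :> algC by rewrite neq0CG.
have SS : S *m S = #|C|%:R *: S.
  by rewrite {1}/S mulmx_suml (eq_bigr (fun=> S)) // sumr_const scaler_nat.
have trS : \tr S = 0.
  rewrite raddf_sum -[RHS]S0; apply: eq_bigr => x Cx.
  by rewrite cfunE sCG // mulr1n.
have := @idempotent_mx_trace0 _ n (#|C|%:R^-1 *: S).
rewrite -scalemxAl -scalemxAr SS !scalerA mulfVK // mxtraceZ trS mulr0.
by move=> /(_ erefl erefl)/eqP; rewrite scaler_eq0 invr_eq0 (negPf nC) => /eqP.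
Qed.

(** In a representation of the alternating group [A_4] without non-zero vectors
fixed by an element [T] of order 3, the Klein four-group acts trivially. Here
[X] and its conjugates [X2], [X3] by powers of [T] play the role of the elements
of the Klein group. Since [X2 * T] is conjugate to [T], it satisfies
the same quadratic equation; comparing the inverses gives
[X2 * T - X * T = X2 - 1], and the sum of the three conjugates of this relation
is [X + X2 + X3 = 3]. *)
Lemma klein_four_fixed_point_free (A : pzRingType) (T X : A) :
    1 + T + T * T = 0 -> T * T * T = 1 -> X * X = 1 ->
    X * (T * T * X * T) * (T * X * (T * T)) = 1 ->
  X *+ 4 = 1 *+ 4.
Proof.
move=> T1 T3 XX; have [T2 DT2] : exists T2, T * T = T2 by exists (T * T).
rewrite DT2 in T1 T3 *.
have T3' : T * T2 = 1 by rewrite -DT2 mulrA DT2.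
have T2T2 : T2 * T2 = T by rewrite -{1}DT2 -mulrA T3' mulr1.
have [X2 DX2] : exists X2, T2 * X * T = X2 by exists (T2 * X * T).
have [X3 DX3] : exists X3, T * X * T2 = X3 by exists (T * X * T2).
rewrite DX2 DX3 => X123.
have TX2 : T * X2 = X * T by rewrite -DX2 !mulrA T3' mul1r.
have X3X3 : X3 * X3 = 1.
  by rewrite -DX3 !mulrA -[_ * T2 * T]mulrA T3 mulr1 -[_ * X * X]mulrA XX mulr1.
have X12 : X * X2 = X3 by rewrite -[RHS]mul1r -X123 -mulrA X3X3 mulr1.
have X13 : X * X3 = X2 by rewrite -X12 mulrA XX mul1r.
have ET2 : T2 = - 1 - T.
  by rewrite -[LHS]add0r -{1}(subrr (1 + T)) addrAC T1 sub0r opprD.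
have XTX : X * T * X = X2 * T.
  by rewrite -X13 -DX3 !mulrA -[_ * T2 * T]mulrA T3 mulr1.
have XT2X : X * T2 * X = T2 * X2.
  transitivity (X3 * T2); last by rewrite -DX3 -mulrA T2T2 -DX2 !mulrA T2T2.
  by rewrite -X12 -DX2 !mulrA -[_ * T * T2]mulrA T3' mulr1.
have E2 : X2 * T - X * T = X2 - 1.
  have := XT2X; rewrite ET2 mulrBr mulrBl mulrN1 mulNr XX XTX mulrBl mulN1r TX2.
  move/(congr1 (+%R X2)); rewrite !addrA subrr sub0r => /(canRL (subrK _)) ->.
  by rewrite addrC.
have conjE Y Z Y' Z' : T2 * Y * T = Y' -> T2 * Z * T = Z' ->
    Y * T - Z * T = Y - 1 -> Y' * T - Z' * T = Y' - 1.
  move=> <- <- /(congr1 (fun z => T2 * z * T)).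
  by rewrite !mulrBr !mulrBl !mulr1 T3 !mulrA.
have X2c : T2 * X2 * T = X3 by rewrite -DX2 !mulrA T2T2 -!mulrA DT2 mulrA.
have X3c : T2 * X3 * T = X by rewrite -DX3 !mulrA T3 mul1r -mulrA T3 mulr1.
have E3 := conjE _ _ _ _ X2c DX2 E2.
have E1 := conjE _ _ _ _ X3c X2c E3.
have sumX : X + X2 + X3 = 1 *+ 3.
  have : X - 1 + (X2 - 1) + (X3 - 1) = 0.
    by rewrite -E1 -E2 -E3 [_ + (X2 * T - _)]addrC !subrKA subrr.
  rewrite [X - 1 + _]addrACA [X + X2 + _ + _]addrACA -!opprD => /subr0_eq ->.
  by rewrite -addrA.
(* Multiplication by [X] permutes [1], [X], [X2] and [X3]. *)
have sumX' : 1 + X3 + X2 = X *+ 3.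
  have := congr1 ( *%R X) sumX.
  by rewrite !mulrDr XX X12 X13 !mulr1.
apply/esym.
rewrite [RHS]mulrSr -sumX' mulrS -sumX -!addrA; congr (_ + _).
by rewrite addrA addrC [X + X2]addrC.
Qed.

(** * Coordinates on SL_2 *)

Section SL2Entries.
Variable R : finComUnitRingType.
Implicit Types (a b c d u v x y z : R) (g h : {'GL_2[R]}).

Definition mx2 a b c d : 'M[R]_2 :=
  \matrix_(i, j) (if i == 0 then if j == 0 then a else b
                  else if j == 0 then c else d).

Lemma mx2_eta (A : 'M[R]_2) : A = mx2 (A 0 0) (A 0 1) (A 1 0) (A 1 1).
Proof.
apply/matrixP => -[[|[|//]] i2] [[|[|//]] j2]; rewrite mxE /=;
  by congr (A _ _); apply: val_inj.
Qed.

Lemma det_mx2 (A : 'M[R]_2) : \det A = A 0 0 * A 1 1 - A 0 1 * A 1 0.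
Proof.
rewrite (expand_det_row _ 0) !big_ord_recl big_ord0 addr0 /cofactor !det_mx11.
rewrite !mxE /= expr0 mul1r expr1 mulN1r mulrN.
by congr (A _ _ * A _ _ - A _ _ * A _ _); apply: val_inj.
Qed.

Lemma mulmx2 (A B : 'M[R]_2) i j : (A *m B) i j = A i 0 * B 0 j + A i 1 * B 1 j.
Proof.
rewrite mxE !big_ord_recl big_ord0 addr0.
by congr (_ + A _ _ * B _ _); apply: val_inj.
Qed.

(** The default value 1 is taken only when the four entries do not form an
invertible matrix. The determinant condition is written [a * d = 1 + b * c]
throughout, with a monomial on the left, because [ring] can then rewrite with
it. *)
Definition sl2 a b c d : {'GL_2[R]} :=
  insubd (1%g : {'GL_2[R]}) (mx2 a b c d).

Lemma sl2_val a b c d : a * d = 1 + b * c -> GLval (sl2 a b c d) = mx2 a b c d.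
Proof.
move=> det1; apply: insubdK; rewrite -topredE /= unitmxE det_mx2 !mxE /= det1.
by rewrite addrK unitr1.
Qed.

Lemma sl2_in a b c d : a * d = 1 + b * c -> sl2 a b c d \in 'SL_2[R].
Proof. by move=> det1; rewrite inE sl2_val // det_mx2 !mxE /= det1 addrK. Qed.

Lemma sl2P g : g \in 'SL_2[R] ->
  exists a, exists b, exists c, exists d, a * d = 1 + b * c /\ g = sl2 a b c d.
Proof.
rewrite inE => /eqP; rewrite det_mx2 => /(canRL (subrK _)) det1.
exists (GLval g 0 0), (GLval g 0 1), (GLval g 1 0), (GLval g 1 1); split=> //.
by apply: val_inj; rewrite [RHS]sl2_val // [LHS]mx2_eta.
Qed.

Definition entry00 g := GLval g 0 0.
Definition entry01 g := GLval g 0 1.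
Definition entry10 g := GLval g 1 0.
Definition entry11 g := GLval g 1 1.

Lemma sl2_entries a b c d : a * d = 1 + b * c ->
  [/\ entry00 (sl2 a b c d) = a, entry01 (sl2 a b c d) = b,
      entry10 (sl2 a b c d) = c & entry11 (sl2 a b c d) = d].
Proof.
by move=> det1; rewrite /entry00 /entry01 /entry10 /entry11 sl2_val // !mxE.
Qed.

Lemma sl2M_det a b c d a' b' c' d' :
    a * d = 1 + b * c -> a' * d' = 1 + b' * c' ->
  (a * a' + b * c') * (c * b' + d * d')
    = 1 + (a * b' + b * d') * (c * a' + d * c').
Proof. by move=> det1 det1'; ring: det1 det1'. Qed.

Lemma sl2M a b c d a' b' c' d' :
    a * d = 1 + b * c -> a' * d' = 1 + b' * c' ->
  (sl2 a b c d * sl2 a' b' c' d')%g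
    = sl2 (a * a' + b * c') (a * b' + b * d') (c * a' + d * c') (c * b' + d * d').
Proof.
move=> det1 det1'; apply: val_inj; rewrite [RHS]sl2_val; last exact: sl2M_det.
rewrite [LHS]GL_MxE !sl2_val // [LHS]mx2_eta !mulmx2 !mxE //=.
Qed.

Lemma sl2V a b c d : a * d = 1 + b * c -> (sl2 a b c d)^-1%g = sl2 d (- b) (- c) a.
Proof.
move=> det1; apply/eqP; rewrite eq_invg_mul sl2M //; last by ring: det1.
apply/eqP/val_inj; rewrite [LHS]sl2_val; last by ring: det1.
rewrite [RHS]mx2_eta /= !mxE /=; congr mx2; ring: det1.
Qed.

End SL2Entries.
Arguments sl2 {R} (a b c d)%_R.

(** * The diagonal torus *)

Section Torus.
Variable R : finComUnitRingType.
Implicit Types (a b c d u v x y z : R) (g h : {'GL_2[R]}).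
Local Notation SL := ('SL_2[R])%G.

Definition diag a : {'GL_2[R]} := sl2 a 0 0 a^-1.

Lemma diag_det a : a \is a GRing.unit -> a * a^-1 = 1 + 0 * 0.
Proof. by move=> Ua; rewrite mul0r addr0 divrr. Qed.

Lemma diag_in a : a \is a GRing.unit -> diag a \in SL.
Proof. by move=> Ua; rewrite sl2_in ?diag_det. Qed.

Lemma entry00_diag a : a \is a GRing.unit -> entry00 (diag a) = a.
Proof. by move=> Ua; have [] := sl2_entries (diag_det Ua). Qed.

Lemma sl2_diag a d : a * d = 1 -> a \is a GRing.unit /\ sl2 a 0 0 d = diag a.
Proof.
move=> ad1; have Ua : a \is a GRing.unit by apply/unitrP; exists d; rewrite mulrC ad1.
by split=> //; rewrite /diag -[in LHS](mulKr Ua d) ad1 mulr1.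
Qed.

Lemma diagM a b : a \is a GRing.unit -> b \is a GRing.unit ->
  diag (a * b) = (diag a * diag b)%g.
Proof.
move=> Ua Ub; rewrite [RHS]sl2M; try exact: diag_det.
by rewrite /diag invrM //; congr sl2; ring.
Qed.

Lemma diag1 : diag 1 = 1%g.
Proof.
have := diagM (unitr1 R) (unitr1 R); rewrite mulr1 => E.
by apply: (mulgI (diag 1)); rewrite mulg1 -E.
Qed.

Definition torus := [set diag a | a in [pred a : R | a \is a GRing.unit]].

Lemma torusP g : reflect (exists2 a, a \is a GRing.unit & g = diag a) (g \in torus).
Proof. exact: imsetP. Qed.

Fact torus_group_set : group_set torus.
Proof.
apply/group_setP; split; first by apply/torusP; exists 1; rewrite ?unitr1 ?diag1.
move=> _ _ /torusP[a Ua ->] /torusP[b Ub ->].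
by apply/torusP; exists (a * b); rewrite ?unitrM ?Ua // diagM.
Qed.
Canonical torus_group := Group torus_group_set.

Lemma diag_torus a : a \is a GRing.unit -> diag a \in torus.
Proof. by move=> Ua; apply/torusP; exists a. Qed.

Lemma torus_sub : torus \subset SL.
Proof. by apply/subsetP=> _ /torusP[a Ua ->]; apply: diag_in. Qed.

Lemma torus_abelian : abelian torus.
Proof.
apply/centsP=> _ /torusP[a Ua ->] _ /torusP[b Ub ->].
by rewrite /commute -!diagM // mulrC.
Qed.

Lemma torus_linear (j : Iirr torus_group) : 'chi_j \is a linear_char.
Proof. exact/char_abelianP/torus_abelian. Qed.

Lemma torus_involution_central g : g \in torus -> (g * g)%g = 1%g -> g \in 'Z(SL).
Proof.
case/torusP=> a Ua ->; rewrite -diagM // -diag1 => /(congr1 (@entry00 R)).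
rewrite !entry00_diag ?unitr1 ?unitrM ?Ua // => aa1.
have Ea : a^-1 = a by rewrite -[RHS](mulKr Ua) aa1 mulr1.
have da : a * a = 1 + 0 * 0 by rewrite aa1; ring.
apply/centerP; split; first exact: diag_in.
move=> _ /sl2P[b [c [d [e [det1 ->]]]]].
by rewrite /diag Ea /commute !sl2M //; congr sl2; ring.
Qed.

Lemma sl2J_det a b c d x y z v : a * d = 1 + b * c -> x * v = 1 + y * z ->
  (v * (a * x + b * z) - y * (c * x + d * z))
      * (x * (c * y + d * v) - z * (a * y + b * v))
    = 1 + (v * (a * y + b * v) - y * (c * y + d * v))
            * (x * (c * x + d * z) - z * (a * x + b * z)).
Proof.
move=> det1 det2.
transitivity ((v * (a * y + b * v) - y * (c * y + d * v))
     * (x * (c * x + d * z) - z * (a * x + b * z))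
   + (x * v - y * z) * (x * v - y * z) * (a * d - b * c)); first by ring.
by rewrite det1 det2 !addrK; ring.
Qed.

Lemma sl2J a b c d x y z v : a * d = 1 + b * c -> x * v = 1 + y * z ->
  (sl2 a b c d ^ sl2 x y z v)%g =
  sl2 (v * (a * x + b * z) - y * (c * x + d * z))
      (v * (a * y + b * v) - y * (c * y + d * v))
      (x * (c * x + d * z) - z * (a * x + b * z))
      (x * (c * y + d * v) - z * (a * y + b * v)).
Proof.
move=> det1 det2; have det3 : v * x = 1 + - y * - z by rewrite mulrC det2; ring.
have det4 : (a * x + b * z) * (c * y + d * v) = 1 + (a * y + b * v) * (c * x + d * z).
  by ring: det1 det2.
by rewrite conjgE sl2V // (sl2M det1 det2) (sl2M det3 det4); congr sl2; ring.
Qed.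

End Torus.

(** * Rings whose maximal ideal is generated by a nilpotent 2 *)

Section DyadicRing.
Variables (R : finComUnitRingType) (n : nat).
Hypothesis parity : forall x : R,
  (exists y, x = 2 * y) \/ (exists y, x = 1 + 2 * y).
Hypothesis two_nilpotent : 2 ^+ n = 0 :> R.
Implicit Types (a b c d u v x y z : R).
Local Notation SL := ('SL_2[R])%G.

Lemma odd_unit y : 1 + 2 * y \is a GRing.unit.
Proof.
pose S := \sum_(i < n) (- (2 * y)) ^+ i.
have E : (- (2 * y)) ^+ n - 1 = (- (2 * y) - 1) * S := subrX1 _ n.
have SE : (1 + 2 * y) * S = 1.
  transitivity (1 - (- (2 * y)) ^+ n); first by rewrite -[RHS]opprB E; ring.
  by rewrite -mulrN exprMn two_nilpotent mul0r subr0.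
by apply/unitrP; exists S; rewrite mulrC SE.
Qed.

Definition dvd2 k : pred R := [pred x | [exists y, x == 2 ^+ k * y]].

Lemma dvd2P k x : reflect (exists y, x = 2 ^+ k * y) (dvd2 k x).
Proof. by apply: (iffP existsP) => -[y /eqP Ey]; exists y => //; apply/eqP. Qed.

Lemma dvd2_le k l x : (k <= l)%N -> dvd2 l x -> dvd2 k x.
Proof.
move=> lekl /dvd2P[y ->]; apply/dvd2P; exists (2 ^+ (l - k) * y).
by rewrite mulrA -exprD subnKC.
Qed.

Lemma dvd20 k : dvd2 k 0.
Proof. by apply/dvd2P; exists 0; rewrite mulr0. Qed.

Lemma dvd2N k x : dvd2 k (- x) = dvd2 k x.
Proof.
by apply/dvd2P/dvd2P=> -[y Ey]; exists (- y); rewrite mulrN -Ey ?opprK.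
Qed.

Lemma dvd2Ml k x y : dvd2 k x -> dvd2 k (x * y).
Proof. by case/dvd2P=> z ->; apply/dvd2P; exists (z * y); rewrite mulrA. Qed.

Lemma dvd2D k x y : dvd2 k x -> dvd2 k y -> dvd2 k (x + y).
Proof.
by case/dvd2P=> [x' ->] /dvd2P[y' ->]; apply/dvd2P; exists (x' + y'); rewrite mulrDr.
Qed.

Lemma valuation k x : ~~ dvd2 k x ->
  exists2 j, (j < k)%N & exists2 v, v \is a GRing.unit & x = 2 ^+ j * v.
Proof.
elim: k x => [|k IHk] x; first by case/dvd2P; exists x; rewrite mul1r.
case: (parity x) => -[y ->] nx; last first.
  by exists 0%N => //; exists (1 + 2 * y); rewrite ?odd_unit ?mul1r.
have [|j ltjk [v Uv Ey]] := IHk y.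
  by apply: contra nx => /dvd2P[z ->]; apply/dvd2P; exists z; rewrite mulrA -exprS.
by exists j.+1 => //; exists v => //; rewrite Ey mulrA -exprS.
Qed.

Lemma diag_units a b c d : a * d = 1 + b * c -> dvd2 1 b || dvd2 1 c ->
  a \is a GRing.unit /\ d \is a GRing.unit.
Proof.
move=> det1 ev; apply/andP; rewrite -unitrM det1.
by case/orP: ev => /dvd2P[y ->]; rewrite expr1 -?mulrA ?[b * _]mulrCA odd_unit.
Qed.

Lemma unit_odd a : a \is a GRing.unit -> exists y, a = 1 + 2 * y.
Proof.
case: (parity a) => -[y -> Ua]; last by exists y.
by move: Ua; rewrite unitrM => /andP[/(unitrX n)]; rewrite two_nilpotent unitr0.
Qed.

Lemma odd_sqr a : a \is a GRing.unit -> exists y, a * a = 1 + 2 ^+ 3 * y.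
Proof.
case/unit_odd=> s ->; have [w Ew] : exists w, s * (s + 1) = 2 * w.
  case: (parity s) => -[r ->]; first by exists (r * (2 * r + 1)); ring.
  by exists ((1 + 2 * r) * (1 + r)); ring.
exists w; transitivity (1 + 2 ^+ 2 * (s * (s + 1))); first by ring.
by rewrite Ew; ring.
Qed.

Section NormalSubgroup.
Variable N : {group {'GL_2[R]}}.
Hypothesis nsN : N <| SL.

Lemma upper_det x : 1 * 1 = 1 + x * 0 :> R. Proof. by ring. Qed.
Lemma lower_det x : 1 * 1 = 1 + 0 * x :> R. Proof. by ring. Qed.

Definition unipotents_in k : Prop :=
  forall z, sl2 1 (2 ^+ k * z) 0 1 \in N /\ sl2 1 0 (2 ^+ k * z) 1 \in N.

Lemma commutator_in g h : g \in N -> h \in SL -> (g * h * g^-1 * h^-1)%g \in N.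
Proof.
move=> Ng Sh; rewrite -!mulgA groupM // [(h * _)%g]mulgA.
have -> : (h * g^-1 * h^-1 = g^-1 ^ h^-1)%g by rewrite conjgE invgK mulgA.
by rewrite memJ_norm ?groupV // (subsetP (normal_norm nsN)) // groupV.
Qed.

(** The commutator of the diagonal matrix of [a] with an upper unipotent matrix
of entry [x] is the upper unipotent matrix of entry [(a ^ 2 - 1) * x]. *)
Lemma diag_commutators a d k w : a * d = 1 -> sl2 a 0 0 d \in N ->
  a * a - 1 = 2 ^+ k * w -> w \is a GRing.unit -> unipotents_in k.
Proof.
move=> ad1 Nad Ea Uw z.
have da1 : d * a = 1 + 0 * 0 by ring: ad1.
have ad1' : a * d = 1 + 0 * 0 by ring: ad1.
have E : 2 ^+ k * z = (a * a - 1) * (z / w) by rewrite Ea; ring: (divrr Uw).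
rewrite E; split.
  have := commutator_in Nad (sl2_in (upper_det (z / w))).
  rewrite !sl2V ?sl2M; try by [ring: ad1].
  by congr (_ \in N); congr sl2; ring: ad1.
have Nda : sl2 d 0 0 a \in N.
  by have := groupVr Nad; rewrite sl2V // oppr0.
have := commutator_in Nda (sl2_in (lower_det (z / w))).
rewrite !sl2V ?sl2M; try by [ring: ad1].
by congr (_ \in N); congr sl2; ring: ad1.
Qed.

Lemma gauss a b c d : a * d = 1 + b * c -> a \is a GRing.unit ->
  sl2 a b c d = (sl2 1 0 (c / a) 1 * sl2 a 0 0 a^-1 * sl2 1 (b / a) 0 1)%g.
Proof.
move=> det1 Ua; have aa1 := divrr Ua.
have aa1' : a * a^-1 = 1 + 0 * 0 by ring: aa1.
rewrite !sl2M; try by [ring: aa1].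
congr sl2; try by [ring: aa1].
transitivity (a^-1 * (a * d)); first by ring: aa1.
by rewrite det1; ring: aa1.
Qed.

Lemma mem_near_diag k a b c d : unipotents_in k -> a * d = 1 + b * c ->
  a \is a GRing.unit -> dvd2 k b -> dvd2 k c ->
  (sl2 a b c d \in N) = (sl2 a 0 0 a^-1 \in N).
Proof.
move=> Nk det1 Ua kb kc; rewrite gauss // groupMr ?groupMl //.
- by have /dvd2P[y ->] := dvd2Ml a^-1 kc; have [] := Nk y.
- by have /dvd2P[y ->] := dvd2Ml a^-1 kb; have [] := Nk y.
Qed.

End NormalSubgroup.

(** * Representations trivial on the torus *)

Section TorusInKernel.
Variables (m : nat) (rG : mx_representation algC SL m).
Local Notation N := (rker rG).
Hypothesis m_gt0 : (0 < m)%N.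
Hypothesis torusN : forall a d, a * d = 1 -> sl2 a 0 0 d \in N.
Let nsN : N <| SL := rker_normal rG.

(** The exponent 3 comes from [3 ^ 2 - 1 = 2 ^ 3]. *)
Lemma torus_kernel_unipotents : unipotents_in N 3.
Proof.
have U3 := odd_unit 1; have uv1 := divrr U3.
by apply: (diag_commutators nsN uv1 (torusN uv1) (w := 1)); [ring | exact: unitr1].
Qed.

Lemma near_diag_kernel k a b c d : (0 < k)%N -> unipotents_in N k ->
  a * d = 1 + b * c -> dvd2 k b -> dvd2 k c -> sl2 a b c d \in N.
Proof.
move=> k_gt0 Nk det1 kb kc; have [Ua _] : a \is a GRing.unit /\ d \is a GRing.unit.
  by apply: (diag_units det1); rewrite (dvd2_le k_gt0).
by rewrite (mem_near_diag Nk) // torusN ?divrr.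
Qed.

Definition elliptic : {'GL_2[R]} := sl2 0 (-1) 1 (-1).

Lemma elliptic_det : 0 * (-1) = 1 + (-1) * 1 :> R. Proof. by ring. Qed.
Lemma elliptic_sqr : (elliptic * elliptic)%g = sl2 (-1) 1 (-1) 0.
Proof. by rewrite sl2M ?elliptic_det //; congr sl2; ring. Qed.
Lemma elliptic_sqr_det : (-1) * 0 = 1 + 1 * (-1) :> R. Proof. by ring. Qed.
Lemma elliptic_cube : (elliptic * elliptic * elliptic)%g = 1%g.
Proof.
rewrite elliptic_sqr sl2M ?elliptic_det ?elliptic_sqr_det //.
have E : 1 * 1 = 1 + 0 * 0 :> R by ring.
rewrite -[RHS](mulgV (sl2 1 0 0 1)) sl2V // sl2M //; try by ring.
by congr sl2; ring.
Qed.

(** A matrix commuting with [elliptic] is a combination of 1 and [elliptic].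
Modulo 2 it is a power of [elliptic], so after multiplication by such a power
its lower left entry [c] is even; the determinant condition
[a ^ 2 - a * c + c ^ 2 = 1] and [a ^ 2 = 1 mod 8] then make [c] divisible by 8,
which is the level of [torus_kernel_unipotents]. *)
Lemma centraliser_elliptic g : g \in 'C_SL[elliptic] ->
  [\/ g \in N, (g * elliptic)%g \in N | (g * elliptic * elliptic)%g \in N].
Proof.
have key a c : a * (a - c) = 1 + (- c) * c -> dvd2 1 c ->
  sl2 a (- c) c (a - c) \in N.
  move=> det1 c_even; have [Ua Ud] : a \is a GRing.unit /\ a - c \is a GRing.unit.
    by apply: (diag_units det1); rewrite c_even orbT.
  have c8 : dvd2 3 c.
    have [y Ey] := odd_sqr Ua; apply/dvd2P; exists (y / (a - c)).
    have Ec : c * (a - c) = 2 ^+ 3 * y.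
      transitivity (a * a - 1); last by rewrite Ey; ring.
      transitivity (a * a - (a * (a - c) + c * c)); first by ring.
      by rewrite det1; ring.
    by rewrite mulrA -Ec mulrK.
  apply: (near_diag_kernel _ torus_kernel_unipotents) => //.
  by rewrite dvd2N (dvd2_le _ c8).
case/setIP=> /sl2P[a [b [c [d [det1 ->]]]]] /cent1P.
move=> E; rewrite /commute !sl2M ?elliptic_det // in E.
have detL := sl2M_det det1 elliptic_det.
have detR := sl2M_det elliptic_det det1.
have [L0 _ L2 _] := sl2_entries detL; have [R0 _ R2 _] := sl2_entries detR.
have Eb : b = - c.
  by have := congr1 (@entry00 R) E; rewrite L0 R0 => E0;
    transitivity (a * 0 + b * 1); [ring | rewrite E0; ring].
have Ed : d = a - c.
  by have := congr1 (@entry10 R) E; rewrite L2 R2 => E0;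
    transitivity (c * 0 + d * 1); [ring | rewrite E0; ring].
subst b d.
have {}det1 : a * a = 1 - c * c + a * c.
  transitivity (a * (a - c) + a * c); [ring | rewrite det1; ring].
have even_or x : dvd2 1 x \/ exists y, x = 1 + 2 * y.
  by case: (parity x) => -[y ->]; [left; apply/dvd2P; exists y | right; exists y].
have [c_even|[c' Ec]] := even_or c.
  by constructor 1; apply: key => //; ring: det1.
have [a_even|[a' Ea]] := even_or a.
  constructor 3; rewrite -mulgA elliptic_sqr sl2M ?elliptic_sqr_det //;
    last by ring: det1.
  rewrite (_ : sl2 _ _ _ _ = sl2 (c - a) (- - a) (- a) (c - a - - a)).
    by apply: key; [ring: det1 | rewrite -mulN1r mulrC dvd2Ml].
  by congr sl2; ring.
constructor 2; rewrite sl2M ?elliptic_det //; last by ring: det1.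
have ca : dvd2 1 (a - c) by apply/dvd2P; exists (a' - c'); rewrite Ea Ec; ring.
rewrite (_ : sl2 _ _ _ _ = sl2 (- c) (- (a - c)) (a - c) (- c - (a - c))).
  by apply: key => //; ring: det1.
by congr sl2; ring.
Qed.

Lemma elliptic_in : elliptic \in SL. Proof. exact: sl2_in elliptic_det. Qed.
Local Notation T := (rG elliptic).

Lemma rkerE g : g \in N -> rG g = 1%:M. Proof. by case/rkerP. Qed.

Lemma repr_elliptic_cube : T *m T *m T = 1%:M.
Proof.
by rewrite -!repr_mxM ?groupM ?elliptic_in // elliptic_cube repr_mx1.
Qed.

Lemma elliptic_fixed_point_free :
  \sum_(h in 'C_SL[elliptic]) cfRepr rG h = 0 -> 1%:M + T + T *m T = 0.
Proof.
move=> S0; have SS : elliptic \in SL := elliptic_in.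
have {S0} := @repr_sum_eq0 _ SL [group of 'C_SL[elliptic]] _ rG (subsetIl _ _) S0.
set P := (1%:M + T + T *m T).
have TP : T *m P = P.
  by rewrite /P !mulmxDr mulmx1 mulmxA repr_elliptic_cube addrC addrA.
have gP g : g \in 'C_SL[elliptic] -> rG g *m P = P.
  move=> Cg; have Sg : g \in SL by case/setIP: Cg.
  case: (centraliser_elliptic Cg) => /rkerE; rewrite ?repr_mxM ?groupM // => Eg.
  - by rewrite Eg mul1mx.
  - by rewrite -{1}TP mulmxA Eg mul1mx.
  - by rewrite -{1}TP -{1}TP !mulmxA Eg mul1mx.
move/(congr1 (mulmx^~ P)); rewrite mulmx_suml (eq_bigr (fun=> P)) // mul0mx.
rewrite sumr_const.
by move/eqP; rewrite -scaler_nat scaler_eq0 (negPf (neq0CG _)) => /eqP.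
Qed.

(** The unipotent matrix [x] of entry [q = 2 ^ k * z] and its conjugates by
[elliptic] satisfy the relations of the Klein four-group modulo matrices with
off-diagonal entries divisible by [2 * q]. *)
Lemma unipotents_descent k : (0 < k)%N -> 1%:M + T + T *m T = 0 ->
  unipotents_in N k.+1 -> unipotents_in N k.
Proof.
move=> k_gt0 T0 Nk z; set q := 2 ^+ k * z.
have q2 y : dvd2 k.+1 (2 * q * y).
  by apply: dvd2Ml; apply/dvd2P; exists z; rewrite exprS mulrA.
have [q' Eq] : exists y, q = 2 * y.
  by exists (2 ^+ k.-1 * z); rewrite mulrA -exprS prednK.
set x : {'GL_2[R]} := sl2 1 q 0 1.
have Sx : x \in SL := sl2_in (upper_det q).
have St := elliptic_in.
have Ex2 : (elliptic * elliptic * x * elliptic)%g = sl2 (1 - q) q (- q) (1 + q).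
  rewrite elliptic_sqr !sl2M; try by ring.
  by congr sl2; ring.
have Ex3 : (elliptic * x * (elliptic * elliptic))%g = sl2 1 0 (- q) 1.
  rewrite elliptic_sqr !sl2M; try by ring.
  by congr sl2; ring.
have xx : rG x *m rG x = 1%:M.
  rewrite -repr_mxM // /x sl2M; try exact: upper_det.
  apply: rkerE.
  apply: (near_diag_kernel _ Nk) => //; first by ring.
    by have := q2 1; congr (dvd2 _ _); ring.
  by have := q2 0; congr (dvd2 _ _); ring.
have xxx : rG x *m (T *m T *m rG x *m T) *m (T *m rG x *m (T *m T)) = 1%:M.
  rewrite -!repr_mxM ?groupM // Ex2 Ex3 /x.
  rewrite !sl2M; try by ring.
  apply: rkerE; apply: (near_diag_kernel _ Nk) => //; first by ring.
    by have := q2 (1 + q'); congr (dvd2 _ _); rewrite Eq; ring.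
  by have := q2 (-1 - q'); congr (dvd2 _ _); rewrite Eq; ring.
have X1 : rG x = 1%:M.
  have := klein_four_fixed_point_free T0 repr_elliptic_cube xx xxx.
  rewrite -!scaler_nat => /scalerI; apply.
  by rewrite pnatr_eq0.
have Nx : x \in N by apply/rkerP.
split=> //.
have : (elliptic * x^-1 * (elliptic * elliptic))%g \in N.
  have -> : (elliptic * elliptic)%g = elliptic^-1%g.
    by apply/eqP; rewrite eq_sym eq_invg_mul mulgA elliptic_cube.
  rewrite -mulgA -[X in (X * _)%g]invgK -conjgE.
  by rewrite memJ_norm ?groupV // (subsetP (normal_norm nsN)) // groupV.
rewrite elliptic_sqr (sl2V (upper_det q)) !sl2M; try by ring.
by congr (_ \in N); congr sl2; ring.
Qed.

Definition unipotent : {'GL_2[R]} := sl2 1 1 0 1.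

Lemma centraliser_unipotent g : unipotents_in N 1 ->
  g \in 'C_SL[unipotent] -> g \in N \/ (g * unipotent)%g \in N.
Proof.
move=> N1 /setIP[/sl2P[a [b [c [d [det1 ->]]]]]] /cent1P E.
rewrite /commute !sl2M // in E; try exact: upper_det.
have detL := sl2M_det det1 (upper_det 1).
have detR := sl2M_det (upper_det 1) det1.
have [L0 _ _ _] := sl2_entries detL; have [R0 _ _ _] := sl2_entries detR.
have c0 : c = 0.
  have := congr1 (@entry00 R) E; rewrite L0 R0 => E0.
  by transitivity (1 * a + 1 * c - a); [ring | rewrite -E0; ring].
subst c; have [Ua Ud] : a \is a GRing.unit /\ d \is a GRing.unit.
  by apply: (diag_units det1); rewrite dvd20 orbT.
have [a' Ea] := unit_odd Ua.
case: (parity b) => -[y Eb]; [left | right; rewrite sl2M //; try exact: upper_det].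
  by apply: (near_diag_kernel _ N1 det1 _ (dvd20 1)) => //; apply/dvd2P; exists y.
apply: (near_diag_kernel _ N1 detL) => //.
  by apply/dvd2P; exists (1 + y + a'); rewrite Eb Ea; ring.
by have := dvd20 1; congr (dvd2 _ _); ring.
Qed.

(** The square of [unipotent] is congruent to 1 modulo 2, so [unipotent] acts as
an involution. *)
Lemma unipotent_fixed_point_free : unipotents_in N 1 ->
  \sum_(h in 'C_SL[unipotent]) cfRepr rG h = 0 -> rG unipotent = - 1%:M.
Proof.
move=> N1 S0; have Su : unipotent \in SL := sl2_in (upper_det 1).
have {S0} := @repr_sum_eq0 _ SL [group of 'C_SL[unipotent]] _ rG (subsetIl _ _) S0.
set U := rG unipotent; set P := (1%:M + U).
have UP : U *m P = P.
  rewrite /P !mulmxDr mulmx1 -repr_mxM // [(_ * _)%g]sl2M; try exact: upper_det.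
  rewrite addrC; congr (_ + _); apply: rkerE.
  apply: (near_diag_kernel _ N1) => //; first by ring.
    by apply/dvd2P; exists 1; ring.
  by apply/dvd2P; exists 0; ring.
have gP g : g \in 'C_SL[unipotent] -> rG g *m P = P.
  move=> Cg; have Sg : g \in SL by case/setIP: Cg.
  case: (centraliser_unipotent N1 Cg) => /rkerE; rewrite ?repr_mxM ?groupM // => Eg.
    by rewrite Eg mul1mx.
  by rewrite -{1}UP mulmxA Eg mul1mx.
move/(congr1 (mulmx^~ P)); rewrite mulmx_suml (eq_bigr (fun=> P)) // mul0mx.
rewrite sumr_const.
move/eqP; rewrite -scaler_nat scaler_eq0 (negPf (neq0CG _)) /= /P addrC addr_eq0.
by move/eqP.
Qed.

Lemma torus_in_kernel_fixed_point :
  exists2 g, g \in SL & \sum_(h in 'C_SL[g]) cfRepr rG h != 0.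
Proof.
have St := elliptic_in; have Su : unipotent \in SL := sl2_in (upper_det 1).
have [S0|] := eqVneq (\sum_(h in 'C_SL[elliptic]) cfRepr rG h) 0;
  last by exists elliptic.
have T0 := elliptic_fixed_point_free S0.
have N2 := @unipotents_descent 2 isT T0 torus_kernel_unipotents.
have N1 := @unipotents_descent 1 isT T0 N2.
exists unipotent => //; apply/eqP => /(unipotent_fixed_point_free N1) U1.
(* The square of [unipotent * elliptic] is the scalar matrix -1. *)
have TT : T *m T = 1%:M.
  have : (unipotent * elliptic * unipotent * elliptic)%g \in N.
    have E : -1 * -1 = 1 :> R by ring.
    have := torusN E; congr (_ \in N).
    by rewrite !sl2M; try ring; congr sl2; ring.
  move/rkerE; rewrite !repr_mxM ?groupM // U1.
  by rewrite mulNmx mul1mx mulmxN mulmx1 opprK.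
have T1 : T = 1%:M by rewrite -repr_elliptic_cube TT mul1mx.
move/eqP: T0; rewrite TT T1 -!mulr2n -mulrSr -scaler_nat scaler_eq0 pnatr_eq0 /=.
move/eqP/(congr1 (@mxtrace _ _)); rewrite mxtrace1 raddf0 => /eqP.
by rewrite pnatr_eq0 -leqn0 leqNgt m_gt0.
Qed.

End TorusInKernel.

(** * The principal series of conductor 2 ^ k *)

Section PrincipalSeries.
Variables (k : nat) (j : Iirr (torus_group R)).
Hypothesis k_gt0 : (0 < k)%N.

Definition weight a := 'chi_j (diag a).

Hypothesis weight_trivial : forall a,
  a \is a GRing.unit -> dvd2 k (a - 1) -> weight a = 1.

Lemma weight1 : weight 1 = 1.
Proof. by rewrite /weight diag1 lin_char1 ?torus_linear. Qed.

Lemma weightM a b : a \is a GRing.unit -> b \is a GRing.unit ->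
  weight (a * b) = weight a * weight b.
Proof.
by move=> Ua Ub; rewrite /weight diagM // lin_charM ?diag_torus ?torus_linear.
Qed.

Lemma weight_congr a b y : a \is a GRing.unit -> b \is a GRing.unit ->
  b = a + 2 ^+ k * y -> weight b = weight a.
Proof.
move=> Ua Ub Eb.
have Uba : a^-1 * b \is a GRing.unit by rewrite unitrM unitrV Ua.
rewrite -(mulVKr Ua b) weightM // [weight (a^-1 * b)]weight_trivial ?mulr1 //.
by apply/dvd2P; exists (a^-1 * y); rewrite Eb mulrDr mulVr //; ring.
Qed.

Definition borel := [set g in SL | dvd2 k (entry10 g)].

Lemma borel_sl2 a b c d : a * d = 1 + b * c -> (sl2 a b c d \in borel) = dvd2 k c.
Proof.
move=> det1; have [_ _ E _] := sl2_entries det1.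
by apply/setIdP/idP; rewrite E ?sl2_in // => -[].
Qed.

Lemma borelP g : g \in borel -> exists a b c d,
  [/\ a * d = 1 + b * c, dvd2 k c, a \is a GRing.unit, d \is a GRing.unit
    & g = sl2 a b c d].
Proof.
case/setIdP=> /sl2P[a [b [c [d [det1 ->]]]]].
have [_ _ -> _] := sl2_entries det1 => kc.
have [|Ua Ud] := diag_units det1; first by rewrite (dvd2_le k_gt0 kc) orbT.
by exists a, b, c, d.
Qed.

Fact borel_group_set : group_set borel.
Proof.
apply/group_setP; split.
  by rewrite -diag1 /diag borel_sl2 ?dvd20 // invr1; ring.
move=> g h /borelP[a [b [c [d [det1 kc _ _ ->]]]]].
case/borelP=> a' [b' [c' [d' [det1' kc' _ _ ->]]]].
rewrite sl2M // (borel_sl2 (sl2M_det det1 det1')).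
by apply: dvd2D; [exact: dvd2Ml | rewrite mulrC; exact: dvd2Ml].
Qed.
Canonical borel_group := Group borel_group_set.

Definition borel_weight g := weight (entry00 g).

Lemma borel_weight_sl2 a b c d : a * d = 1 + b * c ->
  borel_weight (sl2 a b c d) = weight a.
Proof. by rewrite /borel_weight => /sl2_entries[->]. Qed.

(** The upper left entry of a product is the product of the upper left entries
modulo the lower left entry of the second factor. *)
Lemma borel_weightM : {in borel &, {morph borel_weight : g h / (g * h)%g >-> g * h}}.
Proof.
move=> g h /borelP[a [b [c [d [det1 kc Ua _ ->]]]]].
case/borelP=> a' [b' [c' [d' [det1' kc' Ua' _ ->]]]].
have detM := sl2M_det det1 det1'.
rewrite sl2M // !borel_weight_sl2 // -weightM //.
have [y Ec'] := dvd2P _ _ kc'.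
apply: (weight_congr (y := b * y)); rewrite ?unitrM ?Ua //; last first.
  by rewrite Ec'; ring.
have [|//] := diag_units detM; apply/orP; right; apply: (dvd2_le k_gt0).
by apply: dvd2D; [exact: dvd2Ml | rewrite mulrC; exact: dvd2Ml].
Qed.

(** Let [2 ^ l * u] be the lower left entry of [g], with [u] a unit and [l < k].
If [l = 0], the first basis vector and its image under [g] form a basis, and the
matrix with eigenvalues [a0] and [a0^-1] on these vectors is turned by the
conjugation by [g] into one of weight that of [a0^-1]. If [l > 0], an upper
unipotent matrix, of weight 1, is turned into one of upper left entry [a1]. *)
Lemma borel_weight_regular g a0 a1 :
    a0 \is a GRing.unit -> weight a0 * weight a0 != 1 ->
    a1 \is a GRing.unit -> dvd2 k.-1 (a1 - 1) -> weight a1 != 1 ->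
    g \in SL -> g \notin borel ->
  exists h, [/\ h \in borel, (h ^ g)%g \in borel
              & borel_weight (h ^ g)%g != borel_weight h].
Proof.
move=> Ua0 a0V Ua1 ka1 a1_neq1.
case/sl2P=> [x [y [z [v [det2 ->]]]]]; rewrite borel_sl2 //.
case/valuation=> l ltlk [u Uu Ez]; case: l ltlk Ez => [_ Ez | l ltlk Ez].
  have Uz : z \is a GRing.unit by rewrite Ez mul1r.
  (* [t] makes (x, z), the image of the first basis vector, an eigenvector. *)
  pose t := (a0^-1 - a0) * x / z.
  have tz : t * z = (a0^-1 - a0) * x by rewrite divrK.
  have det1 : a0 * a0^-1 = 1 + t * 0 by rewrite mulr0 addr0 divrr.
  exists (sl2 a0 t 0 a0^-1).
  have E10 : x * (0 * x + a0^-1 * z) - z * (a0 * x + t * z) = 0.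
    by rewrite tz; ring.
  have E00 : v * (a0 * x + t * z) - y * (0 * x + a0^-1 * z) = a0^-1.
    transitivity (a0^-1 * (x * v - y * z)); first by rewrite tz; ring.
    by rewrite det2 addrK mulr1.
  have detJ := sl2J_det det1 det2.
  rewrite sl2J // (borel_sl2 detJ) (borel_weight_sl2 detJ) borel_sl2 //.
  rewrite borel_weight_sl2 // E10 E00 dvd20; split=> //.
  apply: contra a0V => /eqP wV; rewrite -{1}wV -weightM ?unitrV //.
  by rewrite mulVr // weight1.
have z_even : dvd2 1 z.
  by apply: (dvd2_le (l := l.+1)) => //; apply/dvd2P; exists u.
have [_ Uv] : x \is a GRing.unit /\ v \is a GRing.unit.
  by apply: (diag_units det2); rewrite z_even orbT.
have [z0 Ea1] := dvd2P _ _ ka1.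
(* [X] is chosen so that [v * X * z = a1 - 1]. *)
pose X := 2 ^+ (k.-1 - l.+1) * (z0 / (u * v)).
have Xz : X * z = (a1 - 1) / v.
  rewrite Ea1 -[k.-1 in RHS](@subnK l.+1) ?exprD; last by rewrite -ltnS prednK.
  rewrite /X Ez invrM //.
  transitivity (2 ^+ (k.-1 - l.+1) * 2 ^+ l.+1 * z0 * v^-1 * (u * u^-1)).
    by ring.
  by rewrite divrr // mulr1.
have det1 : 1 * 1 = 1 + X * 0 := upper_det X.
exists (sl2 1 X 0 1).
have E00 : v * (1 * x + X * z) - y * (0 * x + 1 * z) = a1.
  transitivity (x * v - y * z + v * (X * z)); first by ring.
  by rewrite det2 addrK Xz mulrCA divrr // mulr1 addrC subrK.
have E10 : dvd2 k (x * (0 * x + 1 * z) - z * (1 * x + X * z)).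
  apply/dvd2P; exists (- (2 ^+ l * u * z0 / v)).
  transitivity (- (z * (X * z))); first by ring.
  by rewrite Xz Ea1 [in LHS]Ez -[k in RHS](prednK k_gt0) !exprS; ring.
have detJ := sl2J_det det1 det2.
rewrite sl2J // (borel_sl2 detJ) (borel_weight_sl2 detJ) borel_sl2 //.
rewrite borel_weight_sl2 // E00 dvd20; split=> //.
by rewrite weight1.
Qed.

Definition weyl : {'GL_2[R]} := sl2 0 (-1) 1 0.

Lemma weyl_det : 0 * 0 = 1 + -1 * 1 :> R. Proof. by ring. Qed.

Lemma conj_weyl a b c d : a * d = 1 + b * c ->
  (sl2 a b c d ^ weyl)%g = sl2 d (- c) (- b) a.
Proof. by move=> det1; rewrite sl2J ?weyl_det //; congr sl2; ring. Qed.

Local Notation K := (borel :&: borel :^ weyl^-1).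

Lemma weyl_cell_sl2 a b c d : a * d = 1 + b * c ->
  (sl2 a b c d \in K) = dvd2 k b && dvd2 k c.
Proof.
move=> det1; rewrite inE mem_conjgV conj_weyl // !borel_sl2 //; last by ring: det1.
by rewrite andbC dvd2N.
Qed.

Lemma weyl_cellP g : g \in K -> exists a b c d,
  [/\ a * d = 1 + b * c, dvd2 k b, dvd2 k c, a \is a GRing.unit & g = sl2 a b c d].
Proof.
move=> Kg; have /setIP[/borelP[a [b [c [d [det1 _ Ua _ Eg]]]]] _] := Kg.
by exists a, b, c, d; move: Kg; rewrite Eg weyl_cell_sl2 // => /andP[].
Qed.

Lemma torus_sub_weyl_cell : torus R \subset K.
Proof.
by apply/subsetP => _ /torusP[a Ua ->]; rewrite weyl_cell_sl2 ?diag_det ?dvd20.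
Qed.

(** The map sending a matrix to the diagonal matrix with the same upper left
entry commutes with the translations by the torus, so that its fibres on the
cell all have the same size. *)
Lemma sum_weyl_cell (F : {'GL_2[R]} -> algC) :
  #|torus R|%:R * (\sum_(h in K) F (diag (entry00 h)))
    = #|K|%:R * (\sum_(g in torus R) F g).
Proof.
have shift g h : g \in torus R -> h \in K ->
    diag (entry00 (g * h)%g) = (g * diag (entry00 h))%g.
  case/torusP=> a Ua -> /weyl_cellP[a' [b' [c' [d' [det1 _ _ Ua' ->]]]]].
  have detM := sl2M_det (diag_det Ua) det1.
  rewrite [(_ * _)%g]sl2M ?diag_det //; have [-> _ _ _] := sl2_entries detM.
  by have [-> _ _ _] := sl2_entries det1; rewrite mul0r addr0 diagM.
have shiftK g h : g \in torus R -> ((g * h)%g \in K) = (h \in K).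
  move=> Dg; rewrite (groupMl (G := [group of K])) //.
  exact: subsetP torus_sub_weyl_cell _ Dg.
rewrite !mulr_natl -!sumr_const.
transitivity (\sum_(g in torus R) \sum_(h in K) F (g * diag (entry00 h))%g).
  apply: eq_bigr => g Dg; rewrite (reindex_inj (mulgI g)) /=.
  by apply: eq_big => [h | h]; rewrite shiftK // => Kh; rewrite shift.
rewrite exchange_big /=.
apply: eq_bigr => h /weyl_cellP[a [b [c [d [det1 _ _ Ua ->]]]]].
have [-> _ _ _] := sl2_entries det1.
rewrite [RHS](reindex_inj (mulIg (diag a))) /=.
by apply: eq_bigl => g; rewrite groupMr // diag_torus.
Qed.

(** Conjugation by [weyl] exchanges the diagonal entries, whose product is 1
modulo [2 ^ k], and [gauss] reduces the value of the character to the torus. *)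
Lemma weyl_cell_character (i : Iirr SL) (h : {'GL_2[R]}) :
    unipotents_in (cfker 'chi_i) k -> h \in K ->
  'chi_i h * borel_weight h * (borel_weight (h ^ weyl)%g)^*
    = 'chi_i (diag (entry00 h)) *
        ('chi_j (diag (entry00 h)) * 'chi_j (diag (entry00 h))).
Proof.
move=> Nk /weyl_cellP[a [b [c [d [det1 kb kc Ua ->]]]]].
have [-> _ _ _] := sl2_entries det1.
have [_ Ud] : a \is a GRing.unit /\ d \is a GRing.unit.
  by apply: (diag_units det1); rewrite (dvd2_le k_gt0).
rewrite conj_weyl // !borel_weight_sl2 //; last by ring: det1.
have wad : weight a * weight d = 1.
  rewrite -weightM // det1; have [y Ec] := dvd2P _ _ kc.
  rewrite (weight_congr (a := 1) (y := b * y)) ?weight1 ?unitr1 -?det1 ?unitrM ?Ua //.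
  by rewrite det1 Ec; ring.
have wd : (weight d)^* = weight a.
  rewrite /weight -lin_charV_conj ?torus_linear ?diag_torus // -/(weight a).
  rewrite -[RHS]mulr1 -(lin_char1 (torus_linear j)) -(mulgV (diag d)).
  rewrite lin_charM ?groupV ?diag_torus ?torus_linear //.
  by rewrite mulrA -/(weight d) wad mul1r.
rewrite wd -mulrA; congr (_ * _).
rewrite gauss // cfkerMr; last first.
  by have /dvd2P[y ->] := dvd2Ml a^-1 kb; have [] := Nk y.
by rewrite cfkerMl //; have /dvd2P[y ->] := dvd2Ml a^-1 kc; have [] := Nk y.
Qed.

End PrincipalSeries.

(** * Characters non-trivial on the torus *)

Section TorusOutsideKernel.
Variable i : Iirr SL.
Local Notation N := (cfker 'chi_i).
Local Notation D := (torus_group R).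
Hypothesis centreN : 'Z(SL) \subset N.
Hypothesis torusN : ~~ (torus R \subset N).

(** The inverse of the square of ['chi_j] is a non-trivial constituent of the
restriction of ['chi_i] to the torus. *)
Definition admissible (j : Iirr D) :=
  (\sum_(g in D) 'chi_i g * ('chi_j g * 'chi_j g) != 0)
  && [exists g in D, 'chi_j g * 'chi_j g != 1].

Lemma exists_admissible g : g \in D -> g \notin N ->
  exists2 j, admissible j & 'chi_j g * 'chi_j g != 1.
Proof.
move=> Dg nNg; pose psi := 'Res[D] 'chi_i.
have Npsi : psi \is a character by rewrite cfRes_char ?irr_char.
have kerpsi h : h \in D -> (h \in cfker psi) = (h \in N).
  by move=> Dh; rewrite cfker_Res ?torus_sub ?irr_char // inE Dh.
have [mu mu_psi mu_g] : exists2 mu, mu \in irr_constt psi & 'chi_mu g != 1.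
  have [|none] := pickP [pred mu | (mu \in irr_constt psi) && ('chi_mu g != 1)].
    by move=> mu /andP[]; exists mu.
  case/negP: nNg; rewrite -kerpsi // cfkerE // inE Dg; apply/bigcapP => mu mu_psi.
  rewrite cfkerEirr inE; apply/eqP; rewrite (lin_char1 (torus_linear mu)).
  by have := none mu; rewrite /= mu_psi /= => /negbFE/eqP.
have [j Ej] : exists j : Iirr D,
    {in D, forall h, 'chi_j h * 'chi_j h * 'chi_mu h = 1}.
  apply: exists_inverse_square_root (torus_abelian R) _ => h Dh hh.
  have /cfker1-> : h \in cfker 'chi_mu; last by rewrite (lin_char1 (torus_linear mu)).
  apply: (subsetP (cfker_constt Npsi mu_psi)).
  by rewrite kerpsi // (subsetP centreN) // torus_involution_central.
have Ej' h : h \in D -> 'chi_j h * 'chi_j h = ('chi_mu h)^*.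
  move=> Dh; have := Ej h Dh; rewrite -lin_charV_conj ?torus_linear // => E.
  rewrite -[LHS]mulr1 -(lin_char1 (torus_linear mu)) -(mulgV h).
  rewrite lin_charM ?groupV ?torus_linear //.
  by rewrite mulrA E mul1r.
have gj : 'chi_j g * 'chi_j g != 1.
  rewrite Ej' //; apply: contraNneq mu_g => /(congr1 Num.conj).
  by rewrite conjCK conjC1 => ->.
exists j => //; apply/andP; split; last by apply/exists_inP; exists g.
have : '[psi, 'chi_mu] != 0 by rewrite -irr_consttE.
rewrite cfdotE mulf_eq0 negb_or => /andP[_]; congr (_ != 0).
by apply: eq_bigr => h Dh; rewrite Ej' // cfResE ?torus_sub.
Qed.

(** The conductors of all admissible characters divide [2 ^ k]. *)
Definition trivial_from k := [forall (j | admissible j),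
  [forall g in D, dvd2 k (entry00 g - 1) ==> ('chi_j g == 1)]].

Lemma trivial_fromP k : reflect
  (forall j, admissible j -> forall a, a \is a GRing.unit -> dvd2 k (a - 1) ->
     'chi_j (diag a) = 1) (trivial_from k).
Proof.
apply: (iffP forall_inP) => [tr j adj a Ua ka | tr j adj].
  have /forall_inP/(_ _ (diag_torus Ua)) := tr j adj.
  by rewrite entry00_diag // ka => /eqP.
apply/forall_inP => _ /torusP[a Ua ->]; rewrite entry00_diag //.
by apply/implyP => /(tr j adj a Ua) ->.
Qed.

(** The least [k] with [trivial_from k] is at least 4, because an admissible
character is non-trivial on some square, and the squares of units are 1 modulo
8. *)
Lemma conductor_exists : exists k, [/\ (3 < k)%N, trivial_from k &
  exists j, exists a, [/\ admissible j, a \is a GRing.unit, dvd2 k.-1 (a - 1)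
                        & 'chi_j (diag a) != 1]].
Proof.
have [_ /torusP[a0 Ua0 ->] nN0] := subsetPn torusN.
have [j0 adj0 a0j] := exists_admissible (diag_torus Ua0) nN0.
have ex : exists k, trivial_from k.
  exists n; apply/trivial_fromP => j _ a _ /dvd2P[y].
  rewrite two_nilpotent mul0r => /subr0_eq ->.
  by rewrite diag1 lin_char1 ?torus_linear.
case: (ex_minnP ex) => k /trivial_fromP trk kmin; exists k.
have k3 : (3 < k)%N.
  rewrite ltnNge; apply: contra a0j => lek3; apply/eqP.
  rewrite -(lin_charM (torus_linear j0)) ?diag_torus // -diagM //.
  apply: trk; rewrite ?unitrM ?Ua0 //; apply: (dvd2_le lek3).
  by have [y ->] := odd_sqr Ua0; rewrite addrC addKr; apply/dvd2P; exists y.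
split=> //; first exact/trivial_fromP.
have : ~~ trivial_from k.-1.
  by apply: contraTN k3 => /kmin; case: (k) => // m; rewrite ltnn.
rewrite negb_forall_in => /existsP[j /andP[adj]].
rewrite negb_forall_in => /existsP[_ /andP[/torusP[a Ua ->]]].
by rewrite entry00_diag // negb_imply => /andP[ka aj]; exists j, a.
Qed.

(** If [a = 1] modulo [2 ^ (k - 1)] then [a ^ 2 = 1] modulo [2 ^ k]. So all
squares of admissible characters are trivial at [a], that is, the diagonal
matrix of [a] is in the kernel; for [a = 1 + 2 ^ (k - 1)] its commutators have
level exactly [2 ^ k]. *)
Lemma conductor_unipotents k : (3 < k)%N -> trivial_from k ->
  unipotents_in N k.
Proof.
move=> k3 /trivial_fromP trk.
have k1 : (1 + 2 ^+ k.-1 : R) \is a GRing.unit.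
  have -> : 2 ^+ k.-1 = 2 * 2 ^+ k.-2 :> R by rewrite -exprS; case: (k) k3 => [|[|]].
  exact: odd_unit.
have Ek : 2 ^+ k = 2 * 2 ^+ k.-1 :> R by rewrite -exprS; case: (k) k3.
have Ek2 : 2 ^+ k.-1 * 2 ^+ k.-1 = 2 ^+ k * (2 * 2 ^+ (k - 3)) :> R.
  rewrite -exprS -!exprD; congr (_ ^+ _); case: (k) k3 => [|[|[|m]]] // _.
  by rewrite /= !subSS subn0 !addSn !addnS.
have E : (1 + 2 ^+ k.-1) * (1 + 2 ^+ k.-1) - 1 = 2 ^+ k * (1 + 2 * 2 ^+ (k - 3)) :> R.
  transitivity (2 * 2 ^+ k.-1 + 2 ^+ k.-1 * 2 ^+ k.-1 : R); first by ring.
  by rewrite Ek2 -Ek mulrDr mulr1.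
apply: (diag_commutators (cfker_normal _) (divrr k1) _ E (odd_unit _)).
rewrite -/(diag _); apply: contraT => nN.
have [j adj /negP[]] := exists_admissible (diag_torus k1) nN.
rewrite -(lin_charM (torus_linear j)) ?diag_torus // -diagM // trk ?unitrM ?k1 //.
by rewrite E; apply/dvd2P; eexists; reflexivity.
Qed.

Lemma torus_outside_kernel_constt :
  i \in irr_constt (conjugation_character SL).
Proof.
have [k [k3 trk [j [a1 [adj Ua1 ka1 a1j]]]]] := conductor_exists.
have k_gt0 : (0 < k)%N by apply: leq_trans k3.
have Nk := conductor_unipotents k3 trk.
have wk := trivial_fromP _ trk _ adj.
have /andP[S0 /exists_inP[_ /torusP[a0 Ua0 ->] a0V]] := adj.
pose B := borel_group k_gt0.
have sBG : B \subset SL by apply/subsetP => g /setIdP[].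
have w1 : borel_weight j 1%g = 1.
  by rewrite /borel_weight -diag1 entry00_diag ?unitr1 ?weight1.
have regB g : g \in SL -> g \notin B -> exists h, [/\ h \in B, (h ^ g)%g \in B
    & borel_weight j (h ^ g)%g != borel_weight j h].
  exact: borel_weight_regular a0V _ ka1 a1j.
apply: (constt_conjugation_monomial sBG w1 _ regB (sl2_in weyl_det)).
  exact: borel_weightM.
rewrite (eq_bigr _ (fun h => @weyl_cell_character k j k_gt0 wk i h Nk)).
have nz := neq0CG [group of B :&: B :^ weyl^-1].
apply: contraNneq S0 => SK; apply/eqP/(mulfI nz).
rewrite -(sum_weyl_cell k_gt0 (fun g => 'chi_i g * ('chi_j g * 'chi_j g))).
by rewrite SK !mulr0.
Qed.

End TorusOutsideKernel.

Theorem constt_conjugation_SL2 (i : Iirr SL) : 'Z(SL) \subset cfker 'chi_i ->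
  i \in irr_constt (conjugation_character SL).
Proof.
move=> centreN; have [torusN|] := boolP (torus R \subset cfker 'chi_i).
  have [|a d ad1|g SLg] := torus_in_kernel_fixed_point (rG := 'Chi_i).
  - exact: irr_degree_gt0.
  - have [Ua ->] := sl2_diag ad1.
    by rewrite -cfker_repr irrRepr (subsetP torusN) ?diag_torus.
  by rewrite irrRepr; apply: constt_conjugation_of_centraliser.
exact: torus_outside_kernel_constt.
Qed.

End DyadicRing.

(** * The ring O / p ^ n *)

Section QuotientRing.
Variables (O : dvrType) (resO : residue_field_is_F2 O).
Hypothesis ramO : absolute_ramification_index_one O.
Variables (n : nat) (n_gt0 : (0 < n)%N).
Local Notation On := (quotient_ring resO n_gt0).
Local Notation quot := {ideal_quot (ideal_pow (@max_ideal O) n_gt0)}.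

Lemma quotient_parity (x : On) :
  (exists y : On, x = 2 * y) \/ (exists y : On, x = 1 + 2 * y).
Proof.
elim/quotW: x => x; have [b /ramO[y Ey]] := residue_digit resO x.
have -> : x = b%:R + 2 * y by rewrite -Ey addrC subrK.
case: b {Ey}; [right | left]; exists (\pi_quot%qT y : On).
  have E : \pi_quot%qT (true%:R + 2 * y) = 1 + 2 * \pi_quot%qT y :> quot.
    by rewrite rmorphD rmorphM rmorph1 rmorph_nat.
  exact: E.
have E : \pi_quot%qT (false%:R + 2 * y) = 2 * \pi_quot%qT y :> quot.
  by rewrite add0r rmorphM rmorph_nat.
exact: E.
Qed.

Lemma quotient_two_nilpotent : 2 ^+ n = 0 :> On.
Proof.
have two_p : (2 : O) \in @max_ideal O by apply/ramO; exists 1; rewrite mulr1.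
have : (2 : O) ^+ n \in ideal_pow (@max_ideal O) n_gt0.
  apply/asboolP; exists [:: nseq_tuple n 2].
    by move=> t; rewrite inE => /eqP-> j; rewrite tnth_nseq.
  rewrite big_seq1 (eq_bigr (fun=> 2)) => [|j _]; last by rewrite tnth_nseq.
  by rewrite prodr_const card_ord.
rewrite -[2 ^+ n in X in X -> _]subr0 Quotient.idealrBE => /eqP E.
have {}E : 2 ^+ n = 0 :> quot by move: E; rewrite rmorphXn rmorph_nat rmorph0.
exact: E.
Qed.

End QuotientRing.

Local Open Scope group_scope.

Theorem theorem8p11 (O : dvrType) (resO : residue_field_is_F2 O)
    (ramO : absolute_ramification_index_one O) (n : nat) (n_gt0 : (0 < n)%N)
    (i : Iirr 'SL_2[quotient_ring resO n_gt0])
    (i_triv : 'Z('SL_2[quotient_ring resO n_gt0]) \subset cfker 'chi_i) :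
  i \in irr_constt (conjugation_character 'SL_2[quotient_ring resO n_gt0]).
Proof.
refine (@constt_conjugation_SL2 _ n _ _ i i_triv).
exact: quotient_parity.
exact: quotient_two_nilpotent.
Qed.
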